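(* Let $d$ be an integer with $|d|>1$, let $f:S^1\to S^1$ be a continuous map of degree $d$, and let $F:\mathbb{R}\to\mathbb{R}$ be a lift of $f$. There exist continuous maps $H_F^+:\mathbb{R}\to\mathbb{R}$ and $H_F^-:\mathbb{R}\to\mathbb{R}$ satisfying the following properties: (1) $H_F^+(x+1)=H_F^+(x)+1$ and $H_F^-(x+1)=H_F^-(x)-1$ for all $x\in\mathbb{R}$; (2) $H_F^{\pm}\circ F=d\,H_F^{\pm}$; (3) $|H_F^+(x)-x|$ is bounded and $|H_F^-(x)+x|$ is bounded on $\mathbb{R}$; (4) $H_F^{\pm}(x)=\pm\lim_{n\to\infty}\frac{F^n(x)}{d^n}$ for all $x\in\mathbb{R}$ (in particular the limit exists).
   Context: $S^1=\{z\in\mathbb{C}:|z|=1\}$ with universal covering projection $\pi_0:\mathbb{R}\to S^1$, $\pi_0(x)=\exp(2\pi i x)$. A lift of $f$ is a continuous map $F:\mathbb{R}\to\mathbb{R}$ with $\pi_0 F=f\pi_0$; since $f$ has degree $d$, $F(x+1)=F(x)+d$. *)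

(* Defs.v *)
From mathcomp Require Import all_boot all_order all_algebra.
From mathcomp Require Import complex.
From mathcomp Require Import all_classical all_reals all_analysis.

Set Implicit Arguments.
Unset Strict Implicit.
Unset Printing Implicit Defensive.

Import Order.TTheory GRing.Theory Num.Theory.
Import numFieldNormedType.Exports.

Local Open Scope classical_set_scope.
Local Open Scope complex_scope.
Local Open Scope ring_scope.

(* [R[i]^o] carries the topology of the complex modulus; viewed as a type,
   [S1 R] carries the induced subspace topology. *)
Definition S1 (R : realType) : set (R[i]^o) := [set z | `|z| = 1].
Arguments S1 R _ : clear implicits.

(* exp (i t) is written as cos t + i sin t *)
Definition expi (R : realType) (t : R) : R[i]^o := cos t +i* sin t.

Lemma expi_S1 (R : realType) (t : R) : expi t \in S1 R.
Proof.
apply/mem_set; rewrite /S1 /=.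
by rewrite normc_def /= cos2Dsin2 sqrtr1.
Qed.

Definition pi0 (R : realType) (x : R) : S1 R :=
  exist _ (expi (2 * pi * x)) (expi_S1 (2 * pi * x)).
Arguments pi0 {R} x.

Definition is_lift (R : realType) (f : S1 R -> S1 R) (F : R -> R) : Prop :=
  continuous F /\ pi0 \o F = f \o pi0.

(* A continuous circle map has a lift, any two lifts differ by an integer
   constant, and G (x + 1) - G x is an integer independent of x and of the
   lift G: that integer is the degree. *)
Definition has_degree (R : realType) (f : S1 R -> S1 R) (d : int) : Prop :=
  exists G : R -> R, is_lift f G /\ forall x, G (x + 1) = G x + d%:~R.

(* Main.v *)
(* Two lifts of f differ by a continuous integer-valued function, hence by a
   constant, so F (x + 1) = F x + d and F x - d x is periodic and bounded by
   some M. Therefore consecutive terms of F^n(x) / d^n differ by at most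
   M / |d|^(n+1): the sequence converges uniformly, at bounded distance from its
   initial term x, and the limit inherits the functional equations. *)
Require Import Defs.
From mathcomp Require Import all_boot all_order all_algebra.
From mathcomp Require Import complex.
From mathcomp Require Import all_classical all_reals all_analysis.
From mathcomp Require Import ring lra.

Import Order.TTheory GRing.Theory Num.Theory.
Import numFieldNormedType.Exports.

Local Open Scope classical_set_scope.
Local Open Scope ring_scope.

(** Equal points of the circle make the cosine of the angle difference [2 * pi * (x - y)] equal to
    1, and the double-angle formula then kills the sine of half that angle. *)
Lemma pi0_eq_sin (R : realType) (x y : R) :
  pi0 x = pi0 y -> sin (pi * (x - y)) = 0.
Proof.
move=> /(congr1 sval)/= [ecos esin].
have : cos ((pi * (x - y)) *+ 2) = 1.
  have -> : (pi * (x - y)) *+ 2 = 2 * pi * x - 2 * pi * y by ring.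
  by rewrite cosB ecos esin -!expr2 cos2Dsin2.
rewrite cos_mulr2n => h.
have := cos2Dsin2 (pi * (x - y)) => h2.
by apply/eqP; rewrite -sqrf_eq0; apply/eqP; lra.
Qed.

(* The zeros of sin (pi * _) are the integers; they enter only through the fact
   that two of them cannot differ by an amount in ]0, 1[. *)
Lemma sin_pi_eq0_constant (R : realType) (h : R -> R) :
  continuous h -> (forall x, sin (pi * h x) = 0) -> forall x y, h x = h y.
Proof.
move=> hcont hsin.
suff nlt x y : ~~ (h x < h y).
  by move=> x y; apply/eqP; rewrite eq_le !leNgt !nlt.
apply/negP => hxy.
(* The bound by the gap puts [h x + t] among the values of [h] by the intermediate value theorem;
   the bound by 1/2 keeps [pi * t] strictly between 0 and [pi]. *)
pose t := Num.min 2^-1 (h y - h x).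
have t0 : 0 < t by rewrite lt_min subr_gt0 hxy invr_gt0 ltr0n.
have t1 : t < 1.
  by rewrite gt_min invf_lt1 ?ltr0n// ltr1n.
have ty : h x + t <= h y by rewrite -lerBrDl ge_min lexx orbT.
have [c hc] : exists c, h c = h x + t.
  have [xy|/ltW yx] := leP x y.
  - have [||c _ <-] := @IVT R h x y (h x + t) xy; last by exists c.
    + exact: continuous_subspaceT.
    + by rewrite ge_min le_max ty lerDl (ltW t0) !(orbT, orTb).
  - have [||c _ <-] := @IVT R h y x (h x + t) yx; last by exists c.
    + exact: continuous_subspaceT.
    + by rewrite ge_min le_max ty lerDl (ltW t0) !(orbT, orTb).
(* What remains is cos (pi h(x)) sin (pi t) = 0, yet the cosine is 1 or -1 and the other sine is
   positive. *)
have := hsin c; rewrite hc mulrDr sinD hsin mul0r add0r => /eqP.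
rewrite mulf_eq0 => /orP[/eqP cosx0|/eqP sint0].
  by have := cos2Dsin2 (pi * h x); rewrite hsin cosx0 expr0n/=; lra.
have : 0 < sin (pi * t).
  by rewrite sin_gt0_pi// mulr_gt0 ?pi_gt0//= -[ltRHS]mulr1 ltr_pM2l ?pi_gt0.
by rewrite sint0 ltxx.
Qed.

(** The degree is witnessed by some lift [G], maybe not [F]; since [F - G] is constant, the
    translation rule passes from [G] to [F]. *)
Lemma lift_translate (R : realType) (d : int) (f : S1 R -> S1 R) (F : R -> R) :
  has_degree f d -> is_lift f F -> forall x, F (x + 1) = F x + d%:~R.
Proof.
move=> [G [[Gcont Glift] Gdeg]] [Fcont Flift] x.
have cst : F (x + 1) - G (x + 1) = F x - G x.
  apply: (@sin_pi_eq0_constant R (fun x => F x - G x)) => y.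
    by apply: cvgB; [exact: Fcont | exact: Gcont].
  apply: pi0_eq_sin; have := congr1 (fun k => k y) Flift.
  by have := congr1 (fun k => k y) Glift => /= -> ->.
by move: cst; rewrite Gdeg => cst; lra.
Qed.

Lemma periodic1z (R : realType) (g : R -> R) (k : int) (x : R) :
  periodic g 1 -> g (x + k%:~R) = g x.
Proof.
move=> gper; case: k => n; first by rewrite -pmulrn periodicn.
by rewrite NegzE mulrNz -pmulrn -[in RHS](subrK n.+1%:R x) periodicn.
Qed.

Lemma periodic_bounded (R : realType) (g : R -> R) :
  continuous g -> periodic g 1 -> exists M, forall x, `|g x| <= M.
Proof.
move=> gcont gper.
have [c _ cmax] : exists2 c, c \in `[0, 1]%R &
    forall t, t \in `[0, 1]%R -> `|g t| <= `|g c|.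
  apply: (@EVT_max R (fun x => `|g x|)); first exact: ler01.
  by apply: continuous_subspaceT => y; apply: cvg_norm; exact: gcont.
exists `|g c| => x.
(* Replacing [x] by its fractional part brings it into [0, 1], where the maximum was taken. *)
rewrite -(periodic1z _ g (- Num.floor x))// cmax// in_itv/= mulrNz.
by rewrite subr_ge0 floor_le lerBlDl ltW// -intrD1 floorD1_gt.
Qed.

(** The hypothesis makes [u + e] decrease and [u - e] increase. Their gap [2 e] vanishes, so both
    have the limit of [u], and each term of either sequence bounds that limit from its side. *)
Lemma cvgn_telescope (R : realType) (u e : R^nat) :
  e @ \oo --> 0 -> (forall n, `|u n.+1 - u n| <= e n - e n.+1) ->
  cvgn u /\ forall n, `|limn u - u n| <= e n.
Proof.
move=> e0 ue.
have e_noninc : nonincreasing_seq e.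
  by apply/nonincreasing_seqP => n; rewrite -subr_ge0 (le_trans _ (ue n)).
have e_ge0 n : 0 <= e n.
  by rewrite -(cvg_lim _ e0)//; apply: nonincreasing_cvgn_ge => //; exact: cvgP e0.
have up : nonincreasing_seq (u \+ e).
  by apply/nonincreasing_seqP => n /=; have := ue n; rewrite ler_norml; lra.
have dn : nondecreasing_seq (u \- e).
  by apply/nondecreasing_seqP => n /=; have := ue n; rewrite ler_norml; lra.
have cvup : cvgn (u \+ e).
  apply: nonincreasing_is_cvgn => //; exists (u 0 - e 0) => _ [n _ <-] /=.
  by have /= := dn _ _ (leq0n n); have := e_ge0 n; lra.
pose l := limn (u \+ e).
have ulim : u @ \oo --> l.
  have -> : u = (u \+ e) \- e by apply/funext => n /=; ring.
  by rewrite -[l]subr0; exact: cvgB cvup e0.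
have dnlim : (u \- e) @ \oo --> l.
  by rewrite -[l]subr0; exact: cvgB ulim e0.
split=> [|n]; first exact: cvgP ulim.
rewrite (cvg_lim _ ulim)// ler_norml.
have := nonincreasing_cvgn_ge up cvup n; rewrite -/l /=.
have := nondecreasing_cvgn_le dn (cvgP _ dnlim) n.
by rewrite (cvg_lim _ dnlim)//=; lra.
Qed.

(** The usual eps/3 argument, with the uniform error given as an explicit sequence. *)
Lemma continuous_uniform_dist (R : realType) (u : nat -> R -> R) (H : R -> R)
    (e : R^nat) :
  (forall n, continuous (u n)) -> e @ \oo --> 0 ->
  (forall n x, `|H x - u n x| <= e n) -> continuous H.
Proof.
move=> ucont e0 Hu x; apply/cvgrPdist_lt => eps eps0.
have eps3 : 0 < eps / 3 by rewrite divr_gt0.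
have [n _ /(_ n (leqnn n))/=] := cvgr_dist_lt e 0 e0 _ eps3.
rewrite sub0r normrN => /(le_lt_trans (ler_norm _)) en.
near=> y.
have h1 := Hu n x; have h2 := Hu n y.
have h3 : `|u n x - u n y| < eps / 3.
  by near: y; exact: cvgr_dist_lt _ _ (ucont n x) _ eps3.
by move: h1 h2 h3; rewrite !ler_norml !ltr_norml; lra.
Unshelve. all: by end_near. Qed.

Definition scaled_iter {R : realType} (F : R -> R) (D : R) (n : nat) (x : R) :=
  iter n F x / D ^+ n.

Lemma scaled_iter_continuous (R : realType) (F : R -> R) (D : R) (n : nat) :
  continuous F -> continuous (scaled_iter F D n).
Proof.
move=> Fcont x; apply: cvgMr_tmp; elim: n x => [|n IHn] x /=; first exact: cvg_id.
exact: continuous_comp (IHn x) (Fcont _).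
Qed.

(* The right-hand side is M / |D|^(n+1), written as a telescoping difference. *)
Lemma scaled_iter_step (R : realType) (F : R -> R) (D M : R) (n : nat) (x : R) :
  1 < `|D| -> (forall y, `|F y - D * y| <= M) ->
  `|scaled_iter F D n.+1 x - scaled_iter F D n x| <=
  M / (`|D| - 1) * `|D|^-1 ^+ n - M / (`|D| - 1) * `|D|^-1 ^+ n.+1.
Proof.
move=> D1 FM.
have aD0 : `|D| != 0 by rewrite gt_eqF// (lt_trans ltr01).
have D0 : D != 0 by rewrite -normr_eq0.
have D10 : `|D| - 1 != 0 by rewrite gt_eqF// subr_gt0.
have -> : scaled_iter F D n.+1 x - scaled_iter F D n x =
          (F (iter n F x) - D * iter n F x) / D ^+ n.+1.
  by rewrite /scaled_iter iterS exprS; field; rewrite D0 expf_neq0.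
have -> : M / (`|D| - 1) * `|D|^-1 ^+ n - M / (`|D| - 1) * `|D|^-1 ^+ n.+1 =
          M / `|D| ^+ n.+1.
  by rewrite !exprVn exprS; field; rewrite aD0 expf_neq0.
by rewrite normrM normfV normrX ler_wpM2r ?FM// invr_ge0 exprn_ge0.
Qed.

Theorem lemma1 (R : realType) (d : int) (hd : 1 < `|d|)
    (f : S1 R -> S1 R) (fcont : continuous f) (fdeg : has_degree f d)
    (F : R -> R) (Flift : is_lift f F) :
  exists Hp Hm : R -> R,
    continuous Hp /\ continuous Hm /\
    ((forall x, Hp (x + 1) = Hp x + 1) /\
     (forall x, Hm (x + 1) = Hm x - 1)) /\
    (Hp \o F = (fun x => d%:~R * Hp x) /\
     Hm \o F = (fun x => d%:~R * Hm x)) /\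
    ([bounded Hp x - x | x in [set: R]] /\
     [bounded Hm x + x | x in [set: R]]) /\
    (forall x,
       cvgn (fun n => iter n F x / d%:~R ^+ n) /\
       Hp x = limn (fun n => iter n F x / d%:~R ^+ n) /\
       Hm x = - limn (fun n => iter n F x / d%:~R ^+ n)).
Proof.
have Fcont := Flift.1.
have Fdeg := lift_translate _ _ _ _ fdeg Flift.
set D : R := d%:~R in Fdeg *.
have D1 : 1 < `|D| by rewrite /D -intr_norm ltr1z.
have D0 : D != 0 by rewrite -normr_gt0 (lt_trans ltr01).
have per : periodic (fun x => F x - D * x) 1.
  by move=> x; rewrite Fdeg; ring.
have [M FM] : exists M, forall x, `|F x - D * x| <= M.
  apply: (@periodic_bounded R (fun x => F x - D * x)) => // x.
  by apply: cvgB; [exact: Fcont | apply: cvgMl_tmp; exact: cvg_id].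
pose u := scaled_iter F D.
(* [C] is the sum of M / |D|^(k+1) over k >= 0, and [e n] below is its tail from k = n. *)
pose C := M / (`|D| - 1).
pose e n := C * `|D|^-1 ^+ n.
have e0 : e @ \oo --> 0.
  by apply: cvg_geometric; rewrite normfV normr_id invf_lt1// (lt_trans ltr01).
have ucvg x := cvgn_telescope _ (u^~ x) e e0
  (fun n => scaled_iter_step _ F D M n x D1 FM).
pose H x := limn (u^~ x).
have uH x : u^~ x @ \oo --> H x by exact: (ucvg x).1.
have Hdist n x : `|H x - u n x| <= e n by exact: (ucvg x).2.
have Hcont : continuous H.
  apply: (continuous_uniform_dist _ u H e) => // n.
  exact: scaled_iter_continuous.
have iterD1 n x : iter n F (x + 1) = iter n F x + D ^+ n.
  elim: n => [|n IHn]; first by rewrite expr0.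
  (* The shift [D ^+ n] is the integer [d ^+ n], so it leaves the periodic function F(y) - D y
     unchanged. *)
  rewrite !iterS IHn; have /= := periodic1z _ _ (d ^+ n) (iter n F x) per.
  by rewrite rmorphXn/= -/D exprS; lra.
have HD1 x : H (x + 1) = H x + 1.
  apply: cvg_lim => //.
  have -> : u^~ (x + 1) = fun n => u n x + 1.
    by apply/funext => n; rewrite /u /scaled_iter iterD1 mulrDl divff ?expf_neq0.
  by apply: cvgD; [exact: uH | exact: cvg_cst].
have HF x : H (F x) = D * H x.
  apply: cvg_lim => //.
  (* Starting from [F x] shifts the orbit by one index, which costs a factor [D] and does not affect
     convergence. *)
  have -> : u^~ (F x) = fun n => D * u n.+1 x.
    apply/funext => n; rewrite /u /scaled_iter -iterSr exprS.
    by field; rewrite D0 expf_neq0.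
  by apply: cvgMl_tmp; have := uH x; rewrite -cvg_shiftS.
have Hbound x : `|H x - x| <= C.
  (* At index 0 the scaled iterate is [x] itself and the error is [C]. *)
  by have := Hdist 0 x; rewrite /e /u /scaled_iter/= !expr0 divr1 mulr1.
(* Both limit formulas hold by definition of [H], so [split] closes them. *)
exists H, (fun x => - H x); do !split.
- exact: Hcont.
- by move=> x; apply: cvgN; exact: Hcont.
- exact: HD1.
- by move=> x; rewrite HD1 opprD.
- by apply/funext => x /=; rewrite HF.
- by apply/funext => x /=; rewrite HF mulrN.
- by exists C; split; [exact: num_real | move=> N CN x _; apply: le_trans (ltW CN)].
- exists C; split; [exact: num_real | move=> N CN x _; apply: le_trans (ltW CN)].
  by rewrite addrC -normrN opprD opprK addrC Hbound.
- exact: (ucvg x).1.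
Qed.
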